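(* Let $N\ge 1$ be an integer, $\sigma>0$, $R>0$, and let $b:[0,\infty)\to[0,\infty)$ be continuous and nondecreasing with $0<b(x)\le x^2$ for all $x>0$. Then for every $\alpha\in(0,\infty)$ there exists a unique positive function $u_\alpha\in C^2([0,R])$ satisfying $$u''(r)+\frac{N-1}{r}\,u'(r)=\frac{1}{\sigma^4}\,b(r)\,u(r),\qquad 0<r\le R,$$ $$u(0)=\alpha,\qquad u'(0)=0.$$ Moreover, $u_\alpha$ is convex and strictly increasing on $(0,R]$.
   Context: The function $u_\alpha$ of the radial variable $r=|x|$ is identified with the radially symmetric function $x\mapsto u_\alpha(|x|)$ on the closed ball of radius $R$ in $\mathbb{R}^N$; the ordinary differential equation is the radial form of $\Delta u(x)=\sigma^{-4}b(|x|)u(x)$. $C^2([0,R])$ means twice continuously differentiable up to the endpoints, with one-sided derivatives there. *)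

(* Defs.v *)
From Stdlib Require Export Reals.
Open Scope R_scope.

Definition Icc (a b : R) : R -> Prop := fun x => a <= x <= b.
Definition Ioc (a b : R) : R -> Prop := fun x => a < x <= b.
Definition Ici (a : R) : R -> Prop := fun x => a <= x.

(* [D_in] and [continue_in] take limits within the given set, so at an endpoint
   they are the one-sided derivative and one-sided continuity.  The values of
   the functions outside [a, b] play no role, and for a < b the derivatives
   u1 and u2 are determined on [a, b] by u. *)
Definition C2_with_derivatives (a b : R) (u u1 u2 : R -> R) : Prop :=
  forall x, Icc a b x ->
    D_in u u1 (Icc a b) x /\
    D_in u1 u2 (Icc a b) x /\
    continue_in u2 (Icc a b) x.

Definition positive_on (D : R -> Prop) (u : R -> R) : Prop :=
  forall x, D x -> 0 < u x.

Definition nondecreasing_on (D : R -> Prop) (f : R -> R) : Prop :=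
  forall x y, D x -> D y -> x <= y -> f x <= f y.

Definition strictly_increasing_on (D : R -> Prop) (f : R -> R) : Prop :=
  forall x y, D x -> D y -> x < y -> f x < f y.

(* For use with convex D, such as the intervals above. *)
Definition convex_on (D : R -> Prop) (f : R -> R) : Prop :=
  forall x y t, D x -> D y -> 0 <= t <= 1 ->
    f (t * x + (1 - t) * y) <= t * f x + (1 - t) * f y.

Definition radial_solution (N : nat) (sigma rad : R) (b : R -> R) (alpha : R)
    (u : R -> R) : Prop :=
  exists u1 u2 : R -> R,
    C2_with_derivatives 0 rad u u1 u2 /\
    (forall r, 0 < r <= rad ->
       u2 r + (INR N - 1) / r * u1 r = 1 / sigma ^ 4 * b r * u r) /\
    u 0 = alpha /\
    u1 0 = 0.

(* Main.v *)
Require Import Defs.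
From Stdlib Require Import Reals Lra Lia.
From Coquelicot Require Import Coquelicot.
Open Scope R_scope.

(* With n = N - 1 and c = b / sigma^4, the equation says (r^n u')' = r^n c u, that is
   u' (r) = r^(-n) * int_0^r s^n c u ds and u = alpha + int_0^r u'.  The Picard
   iterates of this linear integral equation converge uniformly in an exponentially
   weighted norm and stay above alpha.  Since c u is nondecreasing, u' (r) / r is at
   most c u / N, so the equation gives u'' >= c u / N > 0: hence u' increases from 0,
   and u is convex and strictly increasing.  Uniqueness is an energy estimate. *)

(** The obstacle is the singular coefficient n / r at 0, where the equation itself says nothing. The
    bound b(x) <= x^2 removes it: together with monotonicity it forces b(0) = 0, so the source c u
    is O(s^2), hence u' = O(t^3), and u' / t extends continuously by 0. The source can therefore be
    continued by 0 to the left of 0; to the right of [rad] the coefficient is frozen. Existence,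
    monotonicity and convexity then concern functions on the whole line with ordinary two-sided
    derivatives, from which the one-sided ones of [radial_solution] follow by restriction. Most
    integral estimates compare derivatives through [is_derive_le] instead of comparing integrals. *)

Lemma is_derive_le (F G f g : R -> R) (a b : R) :
  a <= b ->
  (forall x, a <= x <= b -> is_derive F x (f x)) ->
  (forall x, a <= x <= b -> is_derive G x (g x)) ->
  (forall x, a <= x <= b -> f x <= g x) ->
  F b - F a <= G b - G a.
Proof.
  intros [Hab| <-] HF HG Hfg; [|lra].
  destruct (MVT_cor2 (fun x => G x - F x) (fun x => g x - f x) a b Hab)
    as [c [Heq Hc]].
  - intros x Hx. apply is_derive_Reals, (is_derive_minus G F); auto.
  - specialize (Hfg c ltac:(lra)). simpl in Heq. nra.
Qed.

Lemma is_derive_RInt_0 (f : R -> R) (x : R) :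
  (forall y, continuous f y) -> is_derive (fun t => RInt f 0 t) x (f x).
Proof.
  intros Hf. apply (is_derive_RInt f _ 0).
  - apply filter_forall. intros y. apply (RInt_correct (V := R_CompleteNormedModule) f).
    apply (ex_RInt_continuous (V := R_CompleteNormedModule)). intros z _. apply Hf.
  - apply Hf.
Qed.

Lemma RInt_0_eq_0 (f : R -> R) : RInt f 0 0 = 0.
Proof. apply (RInt_point 0 f). Qed.

Lemma RInt_0_minus (f g : R -> R) (t : R) :
  (forall x, continuous f x) -> (forall x, continuous g x) ->
  RInt (fun s => f s - g s) 0 t = RInt f 0 t - RInt g 0 t.
Proof.
  intros Hf Hg. apply (RInt_minus f g 0 t);
    apply (ex_RInt_continuous (V := R_CompleteNormedModule)); intros z _; auto.
Qed.

Lemma continuous_quadratic_0 (F : R -> R) (K : R) :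
  (forall t, Rabs (F t) <= K * t ^ 2) -> continuous F 0.
Proof.
  intros HF.
  assert (H0 : F 0 = 0).
  { specialize (HF 0). apply Rabs_le_between in HF. lra. }
  apply continuity_pt_filterlim. intros eps Heps.
  assert (HK : 0 <= K).
  { specialize (HF 1). pose proof (Rabs_pos (F 1)). lra. }
  exists (Rmin 1 (eps / (K + 1))). split.
  - apply Rmin_pos; [lra | apply Rdiv_lt_0_compat; lra].
  - intros x [_ Hx]. simpl in Hx |- *. unfold R_dist in *. rewrite H0, Rminus_0_r in *.
    pose proof (Rmin_l 1 (eps / (K + 1))). pose proof (Rmin_r 1 (eps / (K + 1))).
    assert (Hx' : Rabs x * (K + 1) < eps).
    { apply Rlt_div_r; lra. }
    specialize (HF x). rewrite <- pow2_abs in HF.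
    pose proof (Rabs_pos x). nra.
Qed.

Lemma is_derive_cubic_0 (F : R -> R) (K : R) :
  (forall t, Rabs (F t) <= K * Rabs t ^ 3) -> is_derive F 0 0.
Proof.
  intros HF.
  assert (H0 : F 0 = 0).
  { specialize (HF 0). rewrite Rabs_R0 in HF. apply Rabs_le_between in HF. lra. }
  assert (HK : 0 <= K).
  { specialize (HF 1). rewrite Rabs_R1 in HF. pose proof (Rabs_pos (F 1)). lra. }
  apply is_derive_Reals. intros eps Heps.
  assert (Hd : 0 < Rmin 1 (eps / (K + 1))).
  { apply Rmin_pos; [lra | apply Rdiv_lt_0_compat; lra]. }
  exists (mkposreal _ Hd). intros h Hh Hhd. simpl in Hhd.
  pose proof (Rmin_l 1 (eps / (K + 1))). pose proof (Rmin_r 1 (eps / (K + 1))).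
  assert (Hx' : Rabs h * (K + 1) < eps) by (apply Rlt_div_r; lra).
  rewrite Rplus_0_l, H0, !Rminus_0_r. unfold Rdiv. rewrite Rabs_mult, Rabs_inv.
  pose proof (Rabs_pos_lt h Hh).
  apply Rle_lt_trans with (K * Rabs h ^ 2).
  - apply Rle_div_l; [lra|]. specialize (HF h). simpl in *. lra.
  - nra.
Qed.

(** * The first derivative u' as a weighted average of the source, through the singular point *)

(** This is u' when g = c u, from integrating (t^n u')' = t^n g. At [t = 0] the integral runs over a
    point, so the value is 0 for every [n] and the condition u'(0) = 0 is built in. *)
Definition flux (n : nat) (g : R -> R) (t : R) : R :=
  RInt (fun s => s ^ n * g s) 0 t / t ^ n.

Lemma continuous_pow_mult (n : nat) (g : R -> R) :
  (forall x, continuous g x) -> forall x, continuous (fun s => s ^ n * g s) x.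
Proof.
  intros Hg x. apply (continuous_mult (fun s => s ^ n) g); [|apply Hg].
  apply (ex_derive_continuous (fun s => s ^ n)). auto_derive. exact I.
Qed.

(** The product t^n G has derivative n t^(n-1) G + t^n d, and its first term is nonnegative, so the
    product grows at least as fast as both signs of the integral of s^n g. Dividing by t^n, an
    integrated bound on g bounds the flux, with no dependence on [n]. *)
Lemma flux_bound (n : nat) (g G d : R -> R) (t : R) :
  0 < t -> (forall x, continuous g x) ->
  (forall s, 0 <= s <= t -> is_derive G s (d s)) ->
  (forall s, 0 <= s <= t -> 0 <= G s) ->
  (forall s, 0 <= s <= t -> Rabs (g s) <= d s) ->
  Rabs (flux n g t) <= G t.
Proof.
  intros Ht Hg HG HGpos Hgd.
  set (P := fun t => RInt (fun s => s ^ n * g s) 0 t).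
  assert (HP : forall x, is_derive P x (x ^ n * g x)).
  { intros x. apply (is_derive_RInt_0 (fun s => s ^ n * g s)).
    apply continuous_pow_mult, Hg. }
  assert (HP0 : P 0 = 0) by apply RInt_0_eq_0.
  set (Q := fun s => s ^ n * G s).
  set (q := fun s => INR n * s ^ pred n * G s + s ^ n * d s).
  assert (HQ : forall s, 0 <= s <= t -> is_derive Q s (q s)).
  { intros s Hs. unfold Q, q.
    evar_last.
    - apply (is_derive_mult (fun s => s ^ n) G s).
      + apply is_derive_pow, is_derive_id.
      + apply HG, Hs.
      + intros; apply Rmult_comm.
    - unfold plus, mult, one; simpl. ring. }
  assert (Hq : forall s, 0 <= s <= t -> s ^ n * Rabs (g s) <= q s).
  { intros s Hs. unfold q.
    pose proof (pow_le s n (proj1 Hs)). pose proof (pow_le s (pred n) (proj1 Hs)).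
    pose proof (pos_INR n). specialize (Hgd s Hs). specialize (HGpos s Hs).
    assert (0 <= INR n * s ^ pred n * G s) by (repeat apply Rmult_le_pos; auto).
    nra. }
  (* Only the sign of [Q 0] is at hand: for [n = 0] it equals [G 0], which may be positive. *)
  assert (HQ0 : 0 <= Q 0).
  { apply Rmult_le_pos; [apply pow_le | apply HGpos]; lra. }
  assert (H1 : P t - P 0 <= Q t - Q 0).
  { apply is_derive_le with (2 := fun x _ => HP x) (3 := HQ); [lra|].
    intros x Hx. specialize (Hq x Hx). pose proof (pow_le x n (proj1 Hx)).
    pose proof (RRle_abs (g x)). nra. }
  assert (H2 : - P t - - P 0 <= Q t - Q 0).
  { apply (is_derive_le (fun x => - P x) Q (fun x => - (x ^ n * g x)) q); auto; [lra| |].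
    - intros x _. apply (is_derive_opp P), HP.
    - intros x Hx. specialize (Hq x Hx). pose proof (pow_le x n (proj1 Hx)).
      pose proof (RRle_abs (- g x)). rewrite Rabs_Ropp in *. nra. }
  pose proof (pow_lt t n Ht) as Htn.
  unfold flux. fold (P t). unfold Rdiv.
  rewrite Rabs_mult, Rabs_inv, (Rabs_pos_eq (t ^ n)) by lra.
  apply Rle_div_l; [lra|].
  apply Rabs_le. unfold Q in *. lra.
Qed.

Lemma flux_0 (n : nat) (g : R -> R) : flux n g 0 = 0.
Proof. unfold flux. rewrite RInt_0_eq_0. apply Rmult_0_l. Qed.

Lemma flux_nonpos_eq_0 (n : nat) (g : R -> R) (t : R) :
  (forall s, s <= 0 -> g s = 0) -> t <= 0 -> flux n g t = 0.
Proof.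
  intros Hg Ht. unfold flux.
  rewrite (RInt_ext _ (fun _ => 0)).
  - rewrite RInt_const. unfold scal; simpl; unfold mult; simpl. unfold Rdiv. ring.
  - intros x. rewrite Rmin_right, Rmax_left by lra. intros Hx.
    rewrite Hg by lra. simpl. ring.
Qed.

(* Sources that vanish to second order at 0 and to the left of it: for these the
   singular coefficient n / t is harmless at t = 0, division by 0 giving 0. *)
Definition flat_source (g : R -> R) : Prop :=
  (forall x, continuous g x) /\
  (forall s, s <= 0 -> g s = 0) /\
  exists C, forall s, Rabs (g s) <= C * s ^ 2.

(** The equation solved for u''; away from 0 this is also what the quotient rule gives for the
    flux. *)
Definition flux' (n : nat) (g : R -> R) (t : R) : R :=
  g t - INR n * (flux n g t / t).

(** On the right, C t^3 has derivative 3 C t^2, which dominates the source; on the left the flux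
    vanishes. The third power makes the flux differentiable at 0 and the quotient by t continuous
    there. *)
Lemma flux_cubic (n : nat) (g : R -> R) :
  flat_source g ->
  exists C, 0 <= C /\ forall t, Rabs (flux n g t) <= C * Rabs t ^ 3.
Proof.
  intros [Hc [Hneg [C HC]]].
  assert (HC0 : 0 <= C).
  { specialize (HC 1). pose proof (Rabs_pos (g 1)). lra. }
  exists C. split; [exact HC0|]. intros t.
  pose proof (pow_le _ 3 (Rabs_pos t)).
  destruct (Rle_or_lt t 0) as [Ht|Ht].
  - rewrite flux_nonpos_eq_0, Rabs_R0 by assumption. now apply Rmult_le_pos.
  - rewrite (Rabs_pos_eq t) by lra.
    apply (flux_bound n g (fun t => C * t ^ 3) (fun t => C * (3 * t ^ 2))); auto.
    + intros s _. auto_derive; [exact I|]. simpl. ring.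
    + intros s Hs. apply Rmult_le_pos; [|apply pow_le]; lra.
    + intros s _. pose proof (pow2_ge_0 s). specialize (HC s). nra.
Qed.

Lemma is_derive_flux (n : nat) (g : R -> R) (t : R) :
  flat_source g -> is_derive (flux n g) t (flux' n g t).
Proof.
  intros Hg. destruct (Req_dec t 0) as [->|Ht].
  - replace (flux' n g 0) with 0.
    + destruct (flux_cubic n g Hg) as [C [_ HC]]. now apply is_derive_cubic_0 with C.
    + destruct Hg as [_ [Hneg _]]. unfold flux'. rewrite Hneg, flux_0 by lra.
      unfold Rdiv. ring.
  - destruct Hg as [Hc _]. unfold flux, flux'.
    evar_last.
    + apply is_derive_div.
      * apply (is_derive_RInt_0 (fun s => s ^ n * g s)), continuous_pow_mult, Hc.
      * apply is_derive_pow, is_derive_id.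
      * now apply pow_nonzero.
    (* The derivative of t^n carries t^(pred n), so simplification needs [n] split into 0 and a
       successor. *)
    + unfold flux, one; simpl. pose proof (pow_nonzero t n Ht) as Hn.
      set (P := RInt _ _ _). destruct n as [|n].
      * simpl. field. exact Ht.
      * rewrite Nat.pred_succ. simpl pow in *.
        assert (t ^ n <> 0) by now apply pow_nonzero.
        field. auto.
Qed.

Lemma continuous_flux (n : nat) (g : R -> R) (t : R) :
  flat_source g -> continuous (flux n g) t.
Proof.
  intros Hg. apply (ex_derive_continuous (flux n g)).
  exists (flux' n g t). now apply is_derive_flux.
Qed.

Lemma continuous_flux' (n : nat) (g : R -> R) (t : R) :
  flat_source g -> continuous (flux' n g) t.
Proof.
  intros Hg. unfold flux'.
  apply (continuous_minus g); [apply Hg|].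
  apply (continuous_scal_r (INR n) (fun t => flux n g t / t)).
  destruct (Req_dec t 0) as [->|Ht].
  - destruct (flux_cubic n g Hg) as [C [HC0 HC]].
    apply continuous_quadratic_0 with C. intros t.
    destruct (Req_dec t 0) as [->|Ht].
    + rewrite flux_0. unfold Rdiv. rewrite Rmult_0_l, Rabs_R0.
      simpl. lra.
    + unfold Rdiv. rewrite Rabs_mult, Rabs_inv.
      apply Rle_div_l; [now apply Rabs_pos_lt|].
      rewrite <- pow2_abs. specialize (HC t). simpl in *. lra.
  - apply (continuous_mult (flux n g) Rinv).
    + now apply continuous_flux.
    + now apply continuous_Rinv.
Qed.

(** * Inverting the radial Laplacian *)

(** For a flat source, the solution of v'' + (n / r) v' = g with v(0) = v'(0) = 0. *)
Definition radial_potential (n : nat) (g : R -> R) (r : R) : R :=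
  RInt (flux n g) 0 r.

Lemma is_derive_radial_potential (n : nat) (g : R -> R) (r : R) :
  flat_source g -> is_derive (radial_potential n g) r (flux n g r).
Proof.
  intros Hg. apply is_derive_RInt_0. intros y. now apply continuous_flux.
Qed.

Lemma radial_potential_0 (n : nat) (g : R -> R) : radial_potential n g 0 = 0.
Proof. apply RInt_0_eq_0. Qed.

Lemma flat_source_minus (g h : R -> R) :
  flat_source g -> flat_source h -> flat_source (fun s => g s - h s).
Proof.
  intros [Hg [Hg0 [C HC]]] [Hh [Hh0 [D HD]]]. split; [|split].
  - intros x. now apply (continuous_minus g h).
  - intros s Hs. rewrite Hg0, Hh0 by assumption. ring.
  - exists (C + D). intros s. specialize (HC s). specialize (HD s).
    unfold Rminus. eapply Rle_trans; [apply Rabs_triang|]. rewrite Rabs_Ropp. lra.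
Qed.

Lemma radial_potential_minus (n : nat) (g h : R -> R) (r : R) :
  flat_source g -> flat_source h ->
  radial_potential n g r - radial_potential n h r =
  radial_potential n (fun s => g s - h s) r.
Proof.
  intros Hg Hh. unfold radial_potential.
  rewrite <- RInt_0_minus by (intros; now apply continuous_flux).
  apply RInt_ext. intros x _. unfold flux.
  rewrite (RInt_ext (fun s => s ^ n * (g s - h s))
             (fun s => s ^ n * g s - s ^ n * h s)) by (intros; simpl; ring).
  rewrite RInt_0_minus by (apply continuous_pow_mult; first [apply Hg | apply Hh]).
  unfold Rdiv; simpl. ring.
Qed.

(** Each of the two integrations gains a factor 1 / lam against exp(lam s); [flux_bound] provides
    this gain for the weighted one. *)
Lemma radial_potential_exp_bound (n : nat) (g : R -> R) (C lam r : R) :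
  flat_source g -> 0 <= C -> 0 < lam -> 0 <= r ->
  (forall s, 0 <= s <= r -> Rabs (g s) <= C * exp (lam * s)) ->
  Rabs (radial_potential n g r) <= C / lam ^ 2 * exp (lam * r).
Proof.
  intros Hg HC Hlam Hr Hb.
  assert (Hexp : forall K s, is_derive (fun s => K / lam * exp (lam * s)) s
                                       (K * exp (lam * s))).
  { intros K s. auto_derive; [exact I|]. field. lra. }
  assert (Hpos : forall K s, 0 <= K -> 0 <= K / lam * exp (lam * s)).
  { intros K s HK. apply Rmult_le_pos; [apply Rdiv_le_0_compat; lra|].
    left; apply exp_pos. }
  assert (Hf : forall s, 0 <= s <= r ->
                 Rabs (flux n g s) <= C / lam * exp (lam * s)).
  { intros s Hs. destruct (Req_dec s 0) as [->|Hs0].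
    - rewrite flux_0, Rabs_R0. now apply Hpos.
    - apply (flux_bound n g (fun s => C / lam * exp (lam * s))
                            (fun s => C * exp (lam * s))).
      + lra.
      + apply Hg.
      + intros; apply Hexp.
      + intros; now apply Hpos.
      + intros; apply Hb; lra. }
  replace (C / lam ^ 2) with (C / lam / lam) by (field; lra).
  assert (HC' : 0 <= C / lam) by (apply Rdiv_le_0_compat; lra).
  pose proof (Hpos (C / lam) 0 HC') as H0.
  pose proof (radial_potential_0 n g) as HP0.
  set (E := fun s => C / lam / lam * exp (lam * s)).
  assert (H1 : radial_potential n g r - radial_potential n g 0 <= E r - E 0).
  { apply is_derive_le with (f := flux n g)
      (g := fun s => C / lam * exp (lam * s)); auto.
    - intros; now apply is_derive_radial_potential.
    - intros; apply Hexp.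
    - intros x Hx. specialize (Hf x Hx). apply Rabs_le_between in Hf. lra. }
  assert (H2 : - radial_potential n g r - - radial_potential n g 0 <= E r - E 0).
  { apply (is_derive_le (fun r => - radial_potential n g r) E
             (fun x => - flux n g x) (fun s => C / lam * exp (lam * s))); auto.
    - intros. now apply (is_derive_opp (radial_potential n g)), is_derive_radial_potential.
    - intros; apply Hexp.
    - intros x Hx. specialize (Hf x Hx). apply Rabs_le_between in Hf. lra. }
  fold (E r). fold (E 0) in H0. apply Rabs_le. lra.
Qed.

(** * Uniform limits of geometrically convergent sequences *)

Lemma half_pow_small (K eps : R) :
  0 <= K -> 0 < eps -> exists k, K * (1 / 2) ^ k < eps.
Proof.
  intros HK Heps.
  destruct (pow_lt_1_zero (1 / 2)) with (y := eps / (K + 1)) as [k Hk].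
  - rewrite Rabs_pos_eq; lra.
  - apply Rdiv_lt_0_compat; lra.
  - exists k. specialize (Hk k (le_n k)).
    assert (0 < (1 / 2) ^ k) by (apply pow_lt; lra).
    rewrite Rabs_pos_eq in Hk by lra. apply Rlt_div_r in Hk; [|lra]. nra.
Qed.

Lemma geometric_uniform_limit (x : nat -> R -> R) (C : R) :
  (forall k r, continuous (x k) r) ->
  (forall k r, Rabs (x (S k) r - x k r) <= C * (1 / 2) ^ k) ->
  exists f, (forall r, continuous f r) /\
            (forall k r, Rabs (x k r - f r) <= 2 * C * (1 / 2) ^ k).
Proof.
  intros Hcont Hstep.
  assert (HC : 0 <= C).
  { specialize (Hstep O 0). pose proof (Rabs_pos (x 1%nat 0 - x O 0)).
    rewrite pow_O in Hstep. lra. }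
  (* The factor 1 - (1/2)^p is the exact partial geometric sum, which lets the induction on [p]
     close. *)
  assert (Hdiff : forall p k r,
    Rabs (x (p + k)%nat r - x k r) <= 2 * C * (1 / 2) ^ k * (1 - (1 / 2) ^ p)).
  { induction p as [|p IH]; intros k r.
    - simpl. rewrite Rminus_diag, Rabs_R0. lra.
    - replace (x (S p + k)%nat r - x k r)
        with ((x (S (p + k)) r - x (p + k)%nat r) + (x (p + k)%nat r - x k r))
        by (simpl; ring).
      eapply Rle_trans; [apply Rabs_triang|].
      pose proof (Hstep (p + k)%nat r) as H1. specialize (IH k r).
      rewrite pow_add in H1. simpl ((1 / 2) ^ S p). lra. }
  assert (Hhalf : forall k, 0 < (1 / 2) ^ k) by (intros; apply pow_lt; lra).
  assert (Hunif : forall k p r, (k <= p)%nat ->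
    Rabs (x p r - x k r) <= 2 * C * (1 / 2) ^ k).
  { intros k p r Hkp. specialize (Hdiff (p - k)%nat k r).
    replace (p - k + k)%nat with p in Hdiff by lia.
    pose proof (Hhalf k). pose proof (Hhalf (p - k)%nat).
    assert (0 <= 2 * C * (1 / 2) ^ k) by nra. nra. }
  assert (Hlim : forall r, {l : R | Un_cv (fun k => x k r) l}).
  { intros r. apply Rcomplete.R_complete. intros eps Heps.
    destruct (half_pow_small (2 * C) (eps / 2)) as [k Hk]; [lra|lra|]. exists k. intros p q Hp Hq.
    unfold R_dist. replace (x p r - x q r) with ((x p r - x k r) - (x q r - x k r)) by ring.
    pose proof (Hunif k p r Hp) as H1. pose proof (Hunif k q r Hq) as H2.
    apply Rabs_le_between in H1, H2. apply Rabs_def1; lra. }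
  set (f := fun r => proj1_sig (Hlim r)).
  assert (Hf : forall k r, Rabs (x k r - f r) <= 2 * C * (1 / 2) ^ k).
  { intros k r. apply le_epsilon. intros eps Heps.
    destruct (proj2_sig (Hlim r) eps Heps) as [m Hm].
    specialize (Hm (max m k) (Nat.le_max_l m k)). fold (f r) in Hm. unfold R_dist in Hm.
    pose proof (Hunif k (max m k) r (Nat.le_max_r m k)) as H1.
    apply Rabs_def2 in Hm. apply Rabs_le_between in H1. apply Rabs_le. lra. }
  exists f. split; [|exact Hf].
  intros r. apply continuity_pt_filterlim.
  apply (CVU_continuity x f r (mkposreal 1 Rlt_0_1)).
  - intros eps Heps. destruct (half_pow_small (2 * C) eps) as [k Hk]; [lra|lra|]. exists k.
    intros p y Hp _. rewrite Rabs_minus_sym.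
    eapply Rle_lt_trans; [apply Hf|].
    eapply Rle_lt_trans; [|exact Hk].
    apply Rmult_le_compat_l; [lra|].
    replace p with (k + (p - k))%nat by lia. rewrite pow_add.
    pose proof (Hhalf k). pose proof (pow_incr (1/2) 1 (p - k)).
    rewrite pow1 in *. nra.
  - intros p y _. apply continuity_pt_filterlim, Hcont.
  - unfold Boule. rewrite Rminus_diag, Rabs_R0. simpl. lra.
Qed.

(** * Extension from the interval to the whole line *)

(** The projection onto [0, rad]. Composing with it turns continuity within the interval into
    continuity on the line. *)
Definition clamp (rad x : R) : R := Rmax 0 (Rmin rad x).

Lemma clamp_bounds (rad x : R) : 0 < rad -> 0 <= clamp rad x <= rad.
Proof.
  intros H. unfold clamp. split; [apply Rmax_l|].
  apply Rmax_lub; [lra | apply Rmin_l].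
Qed.

Lemma clamp_id (rad x : R) : 0 <= x <= rad -> clamp rad x = x.
Proof.
  intros H. unfold clamp. rewrite Rmin_right, Rmax_right by lra. reflexivity.
Qed.

Lemma clamp_neg (rad x : R) : 0 < rad -> x <= 0 -> clamp rad x = 0.
Proof.
  intros H Hx. unfold clamp. rewrite Rmin_right, Rmax_left by lra. reflexivity.
Qed.

Lemma clamp_lipschitz (rad x y : R) :
  Rabs (clamp rad x - clamp rad y) <= Rabs (x - y).
Proof.
  unfold clamp, Rmax, Rmin, Rabs.
  repeat destruct Rle_dec; repeat destruct Rcase_abs; lra.
Qed.

Lemma continuous_clamp_extension (rad : R) (f : R -> R) :
  0 < rad -> (forall x, Icc 0 rad x -> continue_in f (Icc 0 rad) x) ->
  forall x, continuous (fun y => f (clamp rad y)) x.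
Proof.
  intros Hrad Hf x. apply continuity_pt_filterlim. intros eps Heps.
  pose proof (clamp_bounds rad x Hrad) as Hx.
  destruct (Hf _ Hx eps Heps) as [d [Hd Hdf]].
  exists d. split; [exact Hd|]. intros y [_ Hy].
  (* [continue_in] tests only points other than the base point, so coinciding projections are
     treated apart. *)
  destruct (Req_dec (clamp rad x) (clamp rad y)) as [E|E].
  - simpl. unfold R_dist. rewrite E, Rminus_diag, Rabs_R0. exact Heps.
  - apply Hdf. split.
    + split; [now apply clamp_bounds | exact E].
    + eapply Rle_lt_trans; [apply clamp_lipschitz | exact Hy].
Qed.

Lemma continuous_clamp (rad x : R) : continuous (clamp rad) x.
Proof.
  apply continuity_pt_filterlim. intros eps Heps. exists eps.
  split; [exact Heps|]. intros y [_ Hy].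
  eapply Rle_lt_trans; [apply clamp_lipschitz | exact Hy].
Qed.

(** * The Picard operator and its fixed point *)

Definition bounded_continuous (f : R -> R) : Prop :=
  (forall x, continuous f x) /\ exists B, forall x, Rabs (f x) <= B.

Lemma flat_source_mult (c f : R -> R) :
  flat_source c -> bounded_continuous f -> flat_source (fun s => c s * f s).
Proof.
  intros [Hc [Hc0 [C HC]]] [Hf [B HB]]. split; [|split].
  - intros x. now apply (continuous_mult c f).
  - intros s Hs. rewrite Hc0 by assumption. ring.
  - exists (C * B). intros s. rewrite Rabs_mult.
    replace (C * B * s ^ 2) with (C * s ^ 2 * B) by ring.
    apply Rmult_le_compat; auto using Rabs_pos.
Qed.

(** The projection keeps the image constant outside [0, rad], hence bounded on the line and
    controlled by its values on the interval. *)
Definition picard (n : nat) (c : R -> R) (rad alpha : R) (f : R -> R) (r : R) : R :=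
  alpha + radial_potential n (fun s => c s * f s) (clamp rad r).

Lemma picard_bounded_continuous (n : nat) (c f : R -> R) (rad alpha : R) :
  0 < rad -> flat_source c -> bounded_continuous c -> bounded_continuous f ->
  bounded_continuous (picard n c rad alpha f).
Proof.
  intros Hrad Hc [_ [M HM]] Hf. pose proof (flat_source_mult c f Hc Hf) as Hg.
  destruct Hf as [_ [B HB]].
  assert (HMB : 0 <= M * B).
  { specialize (HM 0). specialize (HB 0).
    pose proof (Rabs_pos (c 0)). pose proof (Rabs_pos (f 0)). nra. }
  split.
  - intros x. unfold picard.
    apply (continuous_plus (fun _ => alpha)
      (fun r => radial_potential n (fun s => c s * f s) (clamp rad r))).
    + apply continuous_const.
    + apply (continuous_comp (clamp rad)); [apply continuous_clamp|].
      apply (ex_derive_continuous (radial_potential n (fun s => c s * f s))).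
      eexists. now apply is_derive_radial_potential.
  (* The exponential bound with [lam = 1]: the source is at most [M * B], and exp(s) >= 1 for s >=
     0. *)
  - exists (Rabs alpha + M * B / 1 ^ 2 * exp (1 * rad)). intros r.
    pose proof (clamp_bounds rad r Hrad) as Hr.
    unfold picard. eapply Rle_trans; [apply Rabs_triang|].
    apply Rplus_le_compat_l.
    eapply Rle_trans.
    + apply (radial_potential_exp_bound n _ (M * B) 1); try lra; [exact Hg|].
      intros s Hs. rewrite Rabs_mult.
      apply Rle_trans with (M * B); [apply Rmult_le_compat; auto using Rabs_pos|].
      pose proof (exp_ineq1_le (1 * s)). nra.
    + apply Rmult_le_compat_l; [simpl; lra|].
      destruct (Req_dec (clamp rad r) rad) as [->|E]; [lra|].
      left. apply exp_increasing. lra.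
Qed.

(* Bielecki's weight [exp (lam * s)] makes the Picard operator a contraction on the
   whole interval, since [M / lam ^ 2 <= 1 / 2] for [lam = 1 + M]. *)
Lemma picard_contraction (n : nat) (c f h : R -> R) (rad alpha M D r : R) :
  0 < rad -> flat_source c -> bounded_continuous f -> bounded_continuous h ->
  (forall s, Rabs (c s) <= M) -> 0 <= D ->
  (forall s, 0 <= s <= rad -> Rabs (f s - h s) <= D * exp ((1 + M) * s)) ->
  0 <= r <= rad ->
  Rabs (picard n c rad alpha f r - picard n c rad alpha h r)
    <= D / 2 * exp ((1 + M) * r).
Proof.
  intros Hrad Hc Hf Hh HM HD Hfh Hr. unfold picard. rewrite clamp_id by assumption.
  assert (HM0 : 0 <= M).
  { specialize (HM 0). pose proof (Rabs_pos (c 0)). lra. }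
  pose proof (flat_source_mult c f Hc Hf) as Hcf.
  pose proof (flat_source_mult c h Hc Hh) as Hch.
  match goal with |- Rabs (_ + ?a - (_ + ?b)) <= _ =>
    replace (alpha + a - (alpha + b)) with (a - b) by ring end.
  rewrite radial_potential_minus by assumption.
  eapply Rle_trans.
  - apply (radial_potential_exp_bound n _ (M * D) (1 + M)).
    + now apply flat_source_minus.
    + now apply Rmult_le_pos.
    + lra.
    + lra.
    + intros s Hs. rewrite <- Rmult_minus_distr_l, Rabs_mult, Rmult_assoc.
      apply Rmult_le_compat; auto using Rabs_pos. apply Hfh. lra.
  - apply Rmult_le_compat_r; [left; apply exp_pos|].
    apply Rle_div_l; [apply pow_lt; lra|]. nra.
Qed.

Lemma flux_nonneg (n : nat) (g : R -> R) (t : R) :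
  (forall x, continuous g x) -> (forall s, 0 <= g s) -> 0 <= t -> 0 <= flux n g t.
Proof.
  intros Hg Hpos [Ht| <-]; [|rewrite flux_0; lra].
  apply Rdiv_le_0_compat; [|now apply pow_lt].
  apply RInt_ge_0; [lra| |].
  - apply (ex_RInt_continuous (V := R_CompleteNormedModule)).
    intros z _. now apply continuous_pow_mult.
  - intros x Hx. apply Rmult_le_pos; [apply pow_le; lra | apply Hpos].
Qed.

Lemma radial_potential_nonneg (n : nat) (g : R -> R) (r : R) :
  flat_source g -> (forall s, 0 <= g s) -> 0 <= r -> 0 <= radial_potential n g r.
Proof.
  intros Hg Hpos Hr. apply RInt_ge_0; [lra| |].
  - apply (ex_RInt_continuous (V := R_CompleteNormedModule)).
    intros z _. now apply continuous_flux.
  - intros x Hx. apply flux_nonneg; [apply Hg | exact Hpos | lra].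
Qed.

(** Replacing g(s) by g(t) under the integral leaves t^(n+1) g(t) / (n+1), the value [Q t] below. *)
Lemma flux_le_of_max_at_end (n : nat) (g : R -> R) (t : R) :
  0 < t -> (forall x, continuous g x) -> (forall s, 0 <= s <= t -> g s <= g t) ->
  INR (S n) * flux n g t <= t * g t.
Proof.
  intros Ht Hg Hmax.
  pose proof (pow_lt t n Ht) as Htn.
  assert (HN : 0 < INR (S n)) by apply lt_0_INR, Nat.lt_0_succ.
  set (P := fun t => RInt (fun s => s ^ n * g s) 0 t).
  set (Q := fun s => s ^ S n / INR (S n) * g t).
  assert (H : P t - P 0 <= Q t - Q 0).
  { apply (is_derive_le P Q (fun s => s ^ n * g s) (fun s => s ^ n * g t)); [lra| | |].
    - intros x _. apply (is_derive_RInt_0 (fun s => s ^ n * g s)).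
      now apply continuous_pow_mult.
    - intros x _. unfold Q. auto_derive; [exact I|].
      change (1 * (INR (S n) * x ^ n) * / INR (S n) * g t = x ^ n * g t).
      field. lra.
    - intros x Hx. apply Rmult_le_compat_l; [now apply pow_le | now apply Hmax]. }
  assert (HP0 : P 0 = 0) by apply RInt_0_eq_0.
  assert (HQ0 : Q 0 = 0) by (unfold Q; simpl; unfold Rdiv; ring).
  unfold flux. fold (P t).
  replace (t * g t) with (INR (S n) * (Q t / t ^ n)).
  - apply Rmult_le_compat_l; [lra|].
    apply Rmult_le_compat_r; [left; now apply Rinv_0_lt_compat | lra].
  - unfold Q. simpl pow. field. split; lra.
Qed.

Lemma picard_fixed_point (n : nat) (c : R -> R) (rad alpha : R) :
  0 < rad -> 0 < alpha -> flat_source c -> bounded_continuous c ->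
  (forall s, 0 <= c s) ->
  exists f, bounded_continuous f /\ (forall r, alpha <= f r) /\
    forall r, 0 <= r <= rad -> f r = picard n c rad alpha f r.
Proof.
  intros Hrad Halpha Hc Hbc Hcpos.
  set (T := picard n c rad alpha).
  set (x := fun k => Nat.iter k T (fun _ => alpha)).
  assert (Hxbc : forall k, bounded_continuous (x k)).
  { induction k as [|k IH].
    - split; [intros; apply continuous_const|].
      exists alpha. intros r. simpl. rewrite Rabs_pos_eq; lra.
    - now apply picard_bounded_continuous. }
  assert (Hxpos : forall k r, alpha <= x k r).
  { induction k as [|k IH]; intros r; [simpl; lra|].
    change (x (S k) r) with (T (x k) r). unfold T, picard.
    pose proof (radial_potential_nonneg n (fun s => c s * x k s) (clamp rad r)
                  (flat_source_mult c (x k) Hc (Hxbc k))).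
    enough (0 <= radial_potential n (fun s => c s * x k s) (clamp rad r)) by lra.
    apply H.
    - intros s. apply Rmult_le_pos; [apply Hcpos|]. specialize (IH s). lra.
    - now apply clamp_bounds. }
  destruct (proj2 Hbc) as [M HM].
  destruct (proj2 (Hxbc 1%nat)) as [B HB].
  assert (HM0 : 0 <= M).
  { specialize (HM 0). pose proof (Rabs_pos (c 0)). lra. }
  assert (HB0 : 0 <= B).
  { specialize (HB 0). pose proof (Rabs_pos (x 1%nat 0)). lra. }
  assert (Hexp1 : forall s, 0 <= s -> 1 <= exp ((1 + M) * s)).
  { intros s Hs. pose proof (exp_ineq1_le ((1 + M) * s)). nra. }
  assert (Hweighted : forall k r, 0 <= r <= rad ->
    Rabs (x (S k) r - x k r) <= (B + alpha) * (1 / 2) ^ k * exp ((1 + M) * r)).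
  { induction k as [|k IH]; intros r Hr.
    - specialize (HB r). apply Rabs_le_between in HB.
      change (x 0%nat r) with alpha. specialize (Hexp1 r (proj1 Hr)).
      apply Rabs_le. rewrite pow_O. nra.
    - change (x (S (S k)) r - x (S k) r) with (T (x (S k)) r - T (x k) r).
      eapply Rle_trans.
      + apply picard_contraction with (M := M) (D := (B + alpha) * (1 / 2) ^ k); auto.
        apply Rmult_le_pos; [lra | apply pow_le; lra].
      + simpl. lra. }
  (* Constancy outside the interval spreads the weighted estimate to all of the line; [C] below
     takes the largest weight, the one at [rad]. *)
  assert (Hclamp : forall k r, x k r = x k (clamp rad r)).
  { intros [|k] r; [reflexivity|]. change (T (x k) r = T (x k) (clamp rad r)).
    unfold T, picard. rewrite (clamp_id rad (clamp rad r)); [reflexivity|].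
    now apply clamp_bounds. }
  set (C := (B + alpha) * exp ((1 + M) * rad)).
  assert (Hstep : forall k r, Rabs (x (S k) r - x k r) <= C * (1 / 2) ^ k).
  { intros k r. rewrite (Hclamp (S k)), (Hclamp k).
    pose proof (clamp_bounds rad r Hrad) as Hr.
    eapply Rle_trans; [now apply Hweighted|].
    unfold C. rewrite !Rmult_assoc. apply Rmult_le_compat_l; [lra|].
    rewrite Rmult_comm. apply Rmult_le_compat_r; [apply pow_le; lra|].
    destruct (Req_dec (clamp rad r) rad) as [->|E]; [lra|].
    left. apply exp_increasing. nra. }
  destruct (geometric_uniform_limit x C) as [f [Hfc Hf]].
  { intros k. apply Hxbc. }
  { exact Hstep. }
  assert (HC0 : 0 <= C).
  { apply Rmult_le_pos; [lra | left; apply exp_pos]. }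
  assert (Hfbc : bounded_continuous f).
  { split; [exact Hfc|]. exists (alpha + 2 * C). intros r.
    specialize (Hf 0%nat r). change (x 0%nat r) with alpha in Hf.
    rewrite pow_O in Hf. apply Rabs_le_between in Hf. apply Rabs_le. lra. }
  exists f. split; [exact Hfbc|]. split.
  - intros r. apply le_epsilon. intros eps Heps.
    destruct (half_pow_small (2 * C) eps) as [k Hk]; [lra|lra|].
    specialize (Hf k r). specialize (Hxpos k r). apply Rabs_le_between in Hf. lra.
  (* The iterate [x (S k)], which is [T (x k)], lies within C (1/2)^k of f, and by contraction
     within C E (1/2)^k of [T f]. The contraction accepts the unweighted bound on [x k - f] because
     the weight is at least 1. *)
  - intros r Hr. apply cond_eq. intros eps Heps.
    set (E := exp ((1 + M) * r)).
    assert (HE : 0 < E) by apply exp_pos.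
    destruct (half_pow_small (2 * C + 2 * C * E) eps) as [k Hk]; [nra|lra|].
    assert (Hp : 0 < (1 / 2) ^ k) by (apply pow_lt; lra).
    pose proof (Hf (S k) r) as H1.
    assert (H2 : Rabs (T (x k) r - T f r) <= 2 * C * (1 / 2) ^ k / 2 * E).
    { apply picard_contraction; auto.
      - nra.
      - intros s Hs. specialize (Hf k s). specialize (Hexp1 s (proj1 Hs)).
        assert (0 <= 2 * C * (1 / 2) ^ k) by nra. nra. }
    change (x (S k) r) with (T (x k) r) in H1. simpl pow in H1.
    fold T.
    apply Rabs_le_between in H1, H2. apply Rabs_def1; nra.
Qed.

(** * One-sided against two-sided derivatives, and uniqueness *)

Lemma D_in_of_is_derive (D : R -> Prop) (u u1 : R -> R) (x : R) :
  is_derive u x (u1 x) -> D_in u u1 D x.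
Proof.
  intros H. apply is_derive_Reals, derivable_pt_lim_D_in in H.
  now apply (D_in_imp u u1 no_cond D x).
Qed.

Lemma continue_in_of_continuous (D : R -> Prop) (u : R -> R) (x : R) :
  continuous u x -> continue_in u D x.
Proof.
  intros H. apply continuity_pt_filterlim in H. intros eps Heps.
  destruct (H eps Heps) as [d [Hd Hu]]. exists d. split; [exact Hd|].
  intros y [[_ Hne] Hy]. apply Hu. repeat split; assumption.
Qed.

Lemma is_derive_of_D_in (a b : R) (u u1 : R -> R) (x : R) :
  a < x < b -> D_in u u1 (Icc a b) x -> is_derive u x (u1 x).
Proof.
  intros Hx H. apply is_derive_Reals, derivable_pt_lim_D_in. intros eps Heps.
  destruct (H eps Heps) as [d [Hd Hu]].
  exists (Rmin d (Rmin (x - a) (b - x))). split.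
  - repeat apply Rmin_pos; lra.
  - intros y [[_ Hne] Hy]. simpl in Hy. unfold R_dist in Hy.
    apply Rmin_Rgt_l in Hy as [Hy1 Hy]. apply Rmin_Rgt_l in Hy as [Hy2 Hy3].
    apply Hu. split; [|exact Hy1]. split; [|exact Hne].
    apply Rgt_lt, Rabs_def2 in Hy2, Hy3. unfold Icc. lra.
Qed.

(* Energy argument: for the difference z of two solutions the damping term only
   decreases z'^2 + z^2, so by Gronwall this energy, zero at 0, vanishes. *)
Lemma radial_solution_unique (N : nat) (sigma rad : R) (b : R -> R) (alpha M : R)
    (u v : R -> R) :
  (1 <= N)%nat -> 0 < rad ->
  (forall r, 0 <= r <= rad -> Rabs (1 / sigma ^ 4 * b r) <= M) ->
  radial_solution N sigma rad b alpha u -> radial_solution N sigma rad b alpha v ->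
  forall r, 0 <= r <= rad -> v r = u r.
Proof.
  intros HN Hrad HM [u1 [u2 [Hu [Huode [Hu0 Hu10]]]]] [v1 [v2 [Hv [Hvode [Hv0 Hv10]]]]].
  set (z := fun x => v x - u x). set (z1 := fun x => v1 x - u1 x).
  set (z2 := fun x => v2 x - u2 x).
  (* The exponential is the Gronwall factor. Without damping, the energy has derivative 2 (k + 1) z
     z', at most (1 + M) (z'^2 + z^2) because 2 |z z'| <= z'^2 + z^2 and |k| <= M. *)
  set (E := fun x => (z1 x ^ 2 + z x ^ 2) * exp (- (1 + M) * x)).
  set (e := fun x => (2 * z1 x * (z2 x + z x)
              - (1 + M) * (z1 x ^ 2 + z x ^ 2)) * exp (- (1 + M) * x)).
  assert (HE' : forall x, 0 < x < rad -> is_derive E x (e x)).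
  { intros x Hx. assert (Hx' : Icc 0 rad x) by (unfold Icc; lra).
    destruct (Hu x Hx') as [Hu1 [Hu2 _]]. destruct (Hv x Hx') as [Hv1 [Hv2 _]].
    assert (Hz : is_derive z x (z1 x)).
    { apply (is_derive_minus v u); eapply is_derive_of_D_in; eassumption. }
    assert (Hz1 : is_derive z1 x (z2 x)).
    { apply (is_derive_minus v1 u1); eapply is_derive_of_D_in; eassumption. }
    unfold E. auto_derive.
    - repeat split; eexists; eassumption.
    - rewrite (is_derive_unique (fun y : R => z y) x _ Hz),
        (is_derive_unique (fun y : R => z1 y) x _ Hz1).
      unfold e. ring. }
  assert (He : forall x, 0 < x < rad -> e x <= 0).
  { intros x Hx. unfold e.
    enough (2 * z1 x * (z2 x + z x) <= (1 + M) * (z1 x ^ 2 + z x ^ 2)).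
    { pose proof (exp_pos (- (1 + M) * x)). nra. }
    specialize (Huode x ltac:(lra)). specialize (Hvode x ltac:(lra)).
    specialize (HM x ltac:(lra)).
    assert (Hd : 0 <= (INR N - 1) / x).
    { apply Rdiv_le_0_compat; [|lra]. apply le_INR in HN. simpl in HN. lra. }
    set (k := 1 / sigma ^ 4 * b x) in *. set (d := (INR N - 1) / x) in *.
    assert (Hz2 : z2 x = k * z x - d * z1 x) by (unfold z2, z1, z; lra).
    rewrite Hz2. apply Rabs_le_between in HM.
    pose proof (pow2_ge_0 (z1 x)). pose proof (pow2_ge_0 (z1 x - z x)).
    pose proof (pow2_ge_0 (z1 x + z x)).
    assert (0 <= d * z1 x ^ 2) by now apply Rmult_le_pos.
    assert (2 * (z1 x * z x) * k <= M * (z1 x ^ 2 + z x ^ 2)) by nra.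
    nra. }
  (* The solutions are controlled only on [0, rad], so the mean value theorem is applied to the
     clamped energy, which is continuous across the endpoints. *)
  assert (HEc : forall x, continuous (fun y => E (clamp rad y)) x).
  { assert (Hcont : forall f f1 : R -> R, (forall x, Icc 0 rad x -> D_in f f1 (Icc 0 rad) x) ->
              forall x, continuous (fun y => f (clamp rad y)) x).
    { intros f f1 Hf. apply continuous_clamp_extension; [exact Hrad|].
      intros x Hx. apply (cont_deriv f f1 (Icc 0 rad) x), Hf, Hx. }
    assert (Hz : forall x, continuous (fun y => z (clamp rad y)) x).
    { intros x. apply (continuous_minus (fun y => v (clamp rad y)) (fun y => u (clamp rad y)));
        eapply Hcont; intros; [apply Hv | apply Hu]; assumption. }
    assert (Hz1 : forall x, continuous (fun y => z1 (clamp rad y)) x).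
    { intros x. apply (continuous_minus (fun y => v1 (clamp rad y)) (fun y => u1 (clamp rad y)));
        eapply Hcont; intros; [apply Hv | apply Hu]; assumption. }
    assert (Hsq : forall f : R -> R, (forall x, continuous f x) ->
              forall x, continuous (fun y => f y ^ 2) x).
    { intros f Hf x. apply (continuous_comp f (fun y => y ^ 2)); [apply Hf|].
      apply (ex_derive_continuous (fun y => y ^ 2)). auto_derive. exact I. }
    intros x. unfold E.
    apply (continuous_mult (fun y => z1 (clamp rad y) ^ 2 + z (clamp rad y) ^ 2)
             (fun y => exp (- (1 + M) * clamp rad y))).
    - apply (continuous_plus (fun y => z1 (clamp rad y) ^ 2) (fun y => z (clamp rad y) ^ 2)).
      + now apply (Hsq (fun y => z1 (clamp rad y))).
      + now apply (Hsq (fun y => z (clamp rad y))).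
    - apply (continuous_comp (clamp rad) (fun y => exp (- (1 + M) * y))).
      + apply continuous_clamp.
      + apply (ex_derive_continuous (fun y => exp (- (1 + M) * y))). auto_derive. exact I. }
  intros r Hr.
  (* The intermediate point may be an endpoint, where [He] is silent. Truncating by 0 does not
     change [e] inside the interval and makes the slope nonpositive at every point. *)
  destruct (MVT_gen (fun y => E (clamp rad y)) 0 r (fun y => Rmin 0 (e y))) as [y [Hy HEy]].
  - intros x. rewrite Rmin_left, Rmax_right by lra. intros Hx.
    rewrite Rmin_right by (apply He; lra).
    apply (is_derive_ext_loc E); [|apply HE'; lra].
    assert (Hl : 0 < Rmin x (rad - x)) by (apply Rmin_pos; lra).
    exists (mkposreal _ Hl). intros y Hy.
    rewrite clamp_id; [reflexivity|].
    assert (Hy' : Rabs (y - x) < Rmin x (rad - x)) by exact Hy.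
    apply Rmin_Rgt_l in Hy' as [Hy1 Hy2].
    apply Rgt_lt, Rabs_def2 in Hy1, Hy2. lra.
  - intros x _. apply continuity_pt_filterlim, HEc.
  - rewrite Rmin_left, Rmax_right in Hy by lra. rewrite !clamp_id in HEy by lra.
    pose proof (Rmin_l 0 (e y)).
    assert (HE0 : E 0 = 0).
    { unfold E, z, z1. rewrite Hu0, Hv0, Hu10, Hv10. ring. }
    assert (HEr : E r <= 0) by nra.
    unfold E in HEr. pose proof (exp_pos (- (1 + M) * r)).
    pose proof (pow2_ge_0 (z1 r)). pose proof (pow2_ge_0 (z r)).
    assert (Hz : z r ^ 2 = 0) by nra.
    assert (z r = 0) by nra. unfold z in *. lra.
Qed.

(** * Monotonicity and convexity from derivatives *)

Lemma is_derive_pos_lt (F f : R -> R) (a b : R) :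
  a < b -> (forall x, is_derive F x (f x)) ->
  (forall x, a < x < b -> 0 < f x) -> F a < F b.
Proof.
  intros Hab HF Hf.
  destruct (MVT_cor2 F f a b Hab) as [c [Heq Hc]].
  - intros x _. apply is_derive_Reals, HF.
  - specialize (Hf c Hc). nra.
Qed.

(** At the intermediate point z the graph lies above its tangent line on both sides. Averaging the
    two inequalities with weights t and 1 - t cancels the linear terms, as t (z - x) = (1 - t) (y -
    z). *)
Lemma convex_on_of_derive_nondecreasing (D : R -> Prop) (F f : R -> R) :
  (forall x y z, D x -> D y -> x <= z <= y -> D z) ->
  (forall x, is_derive F x (f x)) -> nondecreasing_on D f -> convex_on D F.
Proof.
  intros HD HF Hf.
  assert (Hle : forall x y t, D x -> D y -> 0 <= t <= 1 -> x <= y ->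
            F (t * x + (1 - t) * y) <= t * F x + (1 - t) * F y).
  { intros x y t Hx Hy Ht Hxy. set (z := t * x + (1 - t) * y).
    assert (Hz : x <= z <= y) by (unfold z; nra).
    assert (HDz : D z) by now apply (HD x y).
    set (L := fun s => f z * s).
    assert (HL : forall s, is_derive L s (f z)).
    { intros s. unfold L. auto_derive; [exact I|]. ring. }
    assert (H1 : F z - F x <= L z - L x).
    { apply (is_derive_le F L f (fun _ => f z)); [lra|auto|auto|].
      intros s Hs. apply Hf; [|exact HDz|lra]. apply (HD x y); auto; lra. }
    assert (H2 : L y - L z <= F y - F z).
    { apply (is_derive_le L F (fun _ => f z) f); [lra|auto|auto|].
      intros s Hs. apply Hf; [exact HDz| |lra]. apply (HD x y); auto; lra. }
    unfold L in *.
    replace (z - x) with ((1 - t) * (y - x)) in * by (unfold z; ring).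
    assert (H3 : t * (F z - F x) <= t * (f z * z - f z * x)).
    { apply Rmult_le_compat_l; [apply Ht | exact H1]. }
    assert (H4 : (1 - t) * (f z * y - f z * z) <= (1 - t) * (F y - F z)).
    { apply Rmult_le_compat_l; [lra | exact H2]. }
    assert (H5 : t * (f z * z - f z * x) = (1 - t) * (f z * y - f z * z)).
    { unfold z. ring. }
    lra. }
  intros x y t Hx Hy Ht. destruct (Rle_or_lt x y) as [Hxy|Hxy]; [now apply Hle|].
  replace (t * x + (1 - t) * y) with ((1 - t) * y + (1 - (1 - t)) * x) by ring.
  replace (t * F x + (1 - t) * F y) with ((1 - t) * F y + (1 - (1 - t)) * F x) by ring.
  apply Hle; auto; lra.
Qed.

Theorem theorem3p1 (N : nat) (sigma rad : R) (b : R -> R)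
    (hN : (1 <= N)%nat) (hsigma : 0 < sigma) (hrad : 0 < rad)
    (hb_nonneg : forall x, 0 <= x -> 0 <= b x)
    (hb_cont : forall x, 0 <= x -> continue_in b (Ici 0) x)
    (hb_mono : nondecreasing_on (Ici 0) b)
    (hb_bound : forall x, 0 < x -> 0 < b x <= x ^ 2) :
  forall alpha, 0 < alpha ->
  exists u : R -> R,
    (positive_on (Icc 0 rad) u /\ radial_solution N sigma rad b alpha u) /\
    (forall v : R -> R,
       positive_on (Icc 0 rad) v -> radial_solution N sigma rad b alpha v ->
       forall r, 0 <= r <= rad -> v r = u r) /\
    convex_on (Ioc 0 rad) u /\
    strictly_increasing_on (Ioc 0 rad) u.
Proof.
  intros alpha Halpha.
  destruct N as [|n]; [lia|].
  set (k := 1 / sigma ^ 4).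
  assert (Hk : 0 < k) by (apply Rdiv_lt_0_compat; [lra | now apply pow_lt]).
  (* If b(0) > 0, take x = min(1, b(0)/2): then b(0) <= b(x) <= x^2 <= x < b(0). *)
  assert (Hb0 : b 0 = 0).
  { destruct (hb_nonneg 0 (Rle_refl 0)) as [H|H]; [|auto].
    assert (Hx : 0 < Rmin 1 (b 0 / 2)) by (apply Rmin_pos; lra).
    pose proof (Rmin_l 1 (b 0 / 2)). pose proof (Rmin_r 1 (b 0 / 2)).
    destruct (hb_bound _ Hx) as [_ Hbx].
    assert (b 0 <= b (Rmin 1 (b 0 / 2))) by (apply hb_mono; unfold Ici; lra).
    nra. }
  assert (Hbsq : forall x, 0 <= x -> b x <= x ^ 2).
  { intros x [Hx| <-]; [now apply hb_bound | rewrite Hb0; simpl; lra]. }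
  (* Since b(0) = 0, clamping continues the coefficient by 0 on the left, as a flat source requires,
     and by a constant on the right, which keeps it bounded. *)
  set (c := fun s => k * b (clamp rad s)).
  assert (Hcl : forall s, 0 <= clamp rad s <= rad) by (intros; now apply clamp_bounds).
  assert (Hcpos : forall s, 0 <= c s).
  { intros s. apply Rmult_le_pos; [lra | apply hb_nonneg, Hcl]. }
  assert (Hcc : forall x, continuous c x).
  { intros x. apply (continuous_scal_r k (fun s => b (clamp rad s))).
    apply continuous_clamp_extension; [exact hrad|].
    intros y Hy eps Heps. destruct (hb_cont y (proj1 Hy) eps Heps) as [d [Hd Hbd]].
    exists d. split; [exact Hd|]. intros w [[[Hw _] Hne] Hwd].
    apply Hbd. repeat split; assumption. }
  assert (Hcf : flat_source c).
  { split; [exact Hcc|]. split.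
    - intros s Hs. unfold c. rewrite clamp_neg, Hb0 by assumption. ring.
    - exists k. intros s. rewrite Rabs_pos_eq by apply Hcpos.
      apply Rmult_le_compat_l; [lra|].
      apply Rle_trans with (clamp rad s ^ 2); [apply Hbsq, Hcl|].
      rewrite <- (pow2_abs s). apply pow_incr. split; [apply Hcl|].
      unfold clamp, Rmax, Rmin, Rabs.
      repeat destruct Rle_dec; destruct Rcase_abs; lra. }
  assert (Hbc : bounded_continuous c).
  { split; [exact Hcc|]. exists (k * b rad). intros s.
    rewrite Rabs_pos_eq by apply Hcpos. apply Rmult_le_compat_l; [lra|].
    apply hb_mono; unfold Ici; [apply Hcl | lra | apply Hcl]. }
  destruct (picard_fixed_point n c rad alpha hrad Halpha Hcf Hbc Hcpos)
    as [f [Hfbc [Hfpos Hffix]]].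
  set (g := fun s => c s * f s).
  assert (Hg : flat_source g) by now apply flat_source_mult.
  assert (Hgpos : forall s, 0 <= g s).
  { intros s. apply Rmult_le_pos; [apply Hcpos|]. specialize (Hfpos s). lra. }
  (* The fixed point [f] is controlled only as a continuous function, and the operator clamps its
     argument. Dropping this clamp gives a function that is differentiable on the whole line and
     equals [f] on [0, rad]. *)
  set (u := fun r => alpha + radial_potential n g r).
  assert (Huf : forall r, 0 <= r <= rad -> f r = u r).
  { intros r Hr. rewrite Hffix by exact Hr. unfold picard.
    now rewrite clamp_id by exact Hr. }
  assert (Hu : forall r, is_derive u r (flux n g r)).
  { intros r. unfold u.
    evar_last.
    - apply (is_derive_plus (fun _ => alpha) (radial_potential n g)).
      + apply is_derive_const.
      + now apply is_derive_radial_potential.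
    - apply Rplus_0_l. }
  assert (Hu1 : forall r, is_derive (flux n g) r (flux' n g r)).
  { intros r. now apply is_derive_flux. }
  (* Weak monotonicity comes first, from the sign of the flux alone: it makes the source
     nondecreasing, which the positivity of u'' and then strict growth rest on. *)
  assert (Hu_mono : forall x y, 0 <= x -> x <= y -> u x <= u y).
  { intros x y Hx Hxy.
    assert (0 - 0 <= u y - u x); [|lra].
    apply (is_derive_le (fun _ => 0) u (fun _ => 0) (flux n g)); auto.
    - intros; apply (is_derive_const 0).
    - intros z Hz. apply flux_nonneg; [apply Hg | exact Hgpos | lra]. }
  assert (Hg_mono : forall x y, 0 <= x -> x <= y -> y <= rad -> g x <= g y).
  { intros x y Hx Hxy Hy. unfold g, c. rewrite !Huf, !clamp_id by lra.
    apply Rmult_le_compat.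
    - apply Rmult_le_pos; [lra | now apply hb_nonneg].
    - rewrite <- Huf by lra. specialize (Hfpos x). lra.
    - apply Rmult_le_compat_l; [lra|]. apply hb_mono; unfold Ici; lra.
    - now apply Hu_mono. }
  assert (Hg_pos : forall r, 0 < r <= rad -> 0 < g r).
  { intros r Hr. unfold g, c. rewrite clamp_id by lra.
    apply Rmult_lt_0_compat; [apply Rmult_lt_0_compat; [exact Hk | now apply hb_bound]|].
    specialize (Hfpos r). lra. }
  assert (Hu2_pos : forall r, 0 < r <= rad -> 0 < flux' n g r).
  { intros r Hr. specialize (Hg_pos r Hr).
    assert (H : INR (S n) * flux n g r <= r * g r).
    { apply flux_le_of_max_at_end; [apply Hr | apply Hg|].
      intros s Hs. apply Hg_mono; lra. }
    assert (H' : INR (S n) * (flux n g r / r) <= g r).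
    { unfold Rdiv. rewrite <- Rmult_assoc. apply Rle_div_l; lra. }
    rewrite S_INR in H'. unfold flux'. pose proof (pos_INR n). nra. }
  assert (Hu1_incr : forall x y, 0 <= x -> x < y -> y <= rad -> flux n g x < flux n g y).
  { intros x y Hx Hxy Hy. apply (is_derive_pos_lt _ (flux' n g)); auto.
    intros z Hz. apply Hu2_pos. lra. }
  assert (Hsol : radial_solution (S n) sigma rad b alpha u).
  { exists (flux n g), (flux' n g). split; [|split; [|split]].
    - intros x Hx. split; [|split].
      + now apply D_in_of_is_derive.
      + now apply D_in_of_is_derive.
      + now apply continue_in_of_continuous, continuous_flux'.
    - intros r Hr. fold k. rewrite S_INR, <- Huf by lra.
      unfold flux'. unfold g at 1, c at 1. rewrite clamp_id by lra. field. lra.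
    - unfold u. rewrite radial_potential_0. apply Rplus_0_r.
    - apply flux_0. }
  exists u. split; [split; [|exact Hsol]|split; [|split]].
  - intros r Hr. rewrite <- Huf by exact Hr. specialize (Hfpos r). lra.
  (* By monotonicity of [b], the coefficient attains its maximum over [0, rad] at [rad]. *)
  - intros v _ Hv. apply (radial_solution_unique (S n) sigma rad b alpha (k * b rad)); auto.
    intros r Hr. fold k. rewrite Rabs_pos_eq.
    + apply Rmult_le_compat_l; [lra|]. apply hb_mono; unfold Ici; lra.
    + apply Rmult_le_pos; [lra | now apply hb_nonneg].
  - apply (convex_on_of_derive_nondecreasing _ u (flux n g)); [|exact Hu|].
    + unfold Ioc. intros; lra.
    + intros x y Hx Hy [Hxy| ->]; [|lra]. left.
      unfold Ioc in *. apply Hu1_incr; lra.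
  - intros x y Hx Hy Hxy. unfold Ioc in *.
    apply (is_derive_pos_lt u (flux n g)); auto. intros z Hz.
    rewrite <- (flux_0 n g). apply Hu1_incr; lra.
Qed.
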